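(* Let $n\ge1$, and let $E$ denote either $\ell^p$ with $0<p<\infty$, or $c_0$. Let $\omega=(p_I)_{I\in\mathcal I_n}\in E(\mathcal I_n)$, $\omega\neq0$, satisfy the quadratic Plücker relations: for every $(n-1)$-tuple $R$ and every $(n+1)$-tuple $S=(s_1,\dots,s_{n+1})$ of indices in $\mathbb N$, $$\sum_{t=1}^{n+1}(-1)^t\,\tilde p_{\,R\,s_t}\;\tilde p_{\,s_1\cdots\widehat{s_t}\cdots s_{n+1}}=0 .$$ Then $\omega$ is decomposable with frame in $E(\mathbb N)$: there exist linearly independent $w_1,\dots,w_n\in E(\mathbb N)$ with $p_I=\det\big(w_r(i_s)\big)_{r,s=1}^n$ for all $I=\{i_1<\dots<i_n\}\in\mathcal I_n$. Explicitly, if $p_{J_0}=1$ for some $J_0=\{j_1<\dots<j_n\}\in\mathcal I_n$, one may take $$w_r(k)=\tilde p_{\,j_1\cdots j_{r-1}\,k\,j_{r+1}\cdots j_n}\qquad(k\in\mathbb N),$$ and then $w_r(j_s)=\delta_{rs}$ for all $r,s$.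
   Context: Scalars are complex. $\mathcal I_n=\binom{\mathbb N}{n}$ is the set of $n$-element subsets of $\mathbb N$. For a countable index set $\Omega$, $E(\Omega)$ is $\ell^p(\Omega)$, respectively $c_0(\Omega)$. Given a family $(p_I)_{I\in\mathcal I_n}$, $\tilde p_{i_1\cdots i_n}$ denotes its alternating extension to ordered $n$-tuples of elements of $\mathbb N$: it is $0$ if an index is repeated, equals $p_I$ when $i_1<\dots<i_n$ and $I=\{i_1,\dots,i_n\}$, and changes by the sign of the permutation when the entries are permuted. $R\,s_t$ denotes the $n$-tuple obtained by appending $s_t$ to $R$; the hat denotes omission. *)

(* Defs.v *)
From HB Require Import structures.
From mathcomp Require Import all_boot all_order all_algebra all_fingroup finmap.
From mathcomp Require Import complex.
From mathcomp Require Import all_classical all_reals all_analysis.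

Set Implicit Arguments.
Unset Strict Implicit.
Unset Printing Implicit Defensive.

Import Order.TTheory GRing.Theory Num.Theory.

Local Open Scope ring_scope.
Local Open Scope complex_scope.
Local Open Scope fset_scope.

(* Indices are counted from 0: the set of naturals is [nat], positions in an
   n-tuple are ['I_n], and the scalars are the complex numbers [R[i]] over an
   arbitrary model [R : realType] of the reals. *)

Record nsubset (n : nat) :=
  NSubset { nsubset_fset :> {fset nat}; _ : #|` nsubset_fset| == n }.
HB.instance Definition _ n := [isSub for @nsubset_fset n].
HB.instance Definition _ n := [Countable of nsubset n by <:].

(* [nelt I s] is the s-th element of I in increasing order. *)
Definition nelt n (I : nsubset n) (s : 'I_n) : nat :=
  nth 0%N (sort leq (enum_fset I)) s.

Variant seq_space (R : realType) := ellp of {posnum R} | c_null.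
Arguments c_null {R}.

Definition in_space (R : realType) (E : seq_space R) (Omega : countType)
    (x : Omega -> R[i]) : Prop :=
  match E with
  | ellp q =>
      (\esum_(i in [set: Omega]%classic)
         (Normc.normc (x i) `^ q%:num)%:E < +oo)%E
  | c_null =>
      forall e : R, 0 < e -> finite_set [set i | e <= Normc.normc (x i)]%classic
  end.

(* The alternating extension. The sum ranges over the permutations putting the
   entries of [t] in strictly increasing order: there is none if an entry is
   repeated, and exactly one otherwise; see [altext_repeat], [altext_sorted]
   and [altext_perm] below. [insub] yields [None] only when the entries of [t]
   do not form an n-element set, in which case the sum is empty anyway. *)
Definition altext (R : realType) n (p : nsubset n -> R[i]) (t : n.-tuple nat)
    : R[i] :=
  \sum_(s : 'S_n | sorted ltn [tuple tnth t (s i) | i < n])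
     (-1) ^+ s * oapp p 0 (insub [fset k in tval t]).

(* For 0 < n, [snoc r k] is the n-tuple obtained by appending k to the
   (n-1)-tuple r. *)
Definition snoc n (r : n.-1.-tuple nat) (k : nat) : n.-tuple nat :=
  [tuple nth 0%N (rcons r k) i | i < n].

Definition omit n (S : n.+1.-tuple nat) (t : 'I_n.+1) : n.-tuple nat :=
  [tuple tnth S (lift t i) | i < n].

(* With t counted from 0, the sign (-1)^t becomes (-1)^(t+1). *)
Definition plucker (R : realType) n (p : nsubset n -> R[i]) : Prop :=
  forall (r : n.-1.-tuple nat) (S : n.+1.-tuple nat),
    \sum_(t < n.+1)
       (-1) ^+ t.+1 * altext p (snoc r (tnth S t)) * altext p (omit S t) = 0.

Definition lin_indep (R : realType) n (w : 'I_n -> nat -> R[i]) : Prop :=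
  forall c : 'I_n -> R[i],
    (forall k : nat, \sum_(r < n) c r * w r k = 0) -> forall r, c r = 0.

Definition is_frame (R : realType) (E : seq_space R) n (p : nsubset n -> R[i])
    (w : 'I_n -> nat -> R[i]) : Prop :=
  [/\ forall r, in_space E (w r),
      lin_indep w
    & forall I : nsubset n, p I = \det (\matrix_(r < n, s < n) w r (nelt I s))].

Definition plucker_frame (R : realType) n (p : nsubset n -> R[i])
    (J : nsubset n) (r : 'I_n) (k : nat) : R[i] :=
  altext p [tuple if s == r then k else nelt J s | s < n].

Section AltextSpec.
Variables (R : realType) (n : nat) (p : nsubset n -> R[i]).
Implicit Types (t : n.-tuple nat) (s : 'S_n).

Lemma altext_repeat t : ~~ uniq t -> altext p t = 0.
Proof.
move=> tN; rewrite /altext big_pred0 // => s.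
apply/negP => /(sorted_uniq ltn_trans ltnn) /tuple_uniqP u.
move/negP: tN; apply; apply/tuple_uniqP => i j tij.
rewrite -(permKV s i) -(permKV s j); congr (s _).
by apply: u; rewrite !tnth_mktuple !permKV.
Qed.

Lemma mem_tuple_perm t s : [seq tnth t (s i) | i <- enum 'I_n] =i t.
Proof.
move=> k; apply/mapP/tnthP => [[i _ ->]|[i ->]]; first by exists (s i).
by exists (s^-1%g i); rewrite ?mem_enum ?permKV.
Qed.

Lemma altext_perm t s :
  altext p [tuple tnth t (s i) | i < n] = (-1) ^+ s * altext p t.
Proof.
rewrite /altext mulr_sumr (reindex_inj (mulIg s^-1%g)) /=.
apply: eq_big => [u|u _].
  by congr (sorted _ _); apply: eq_map => i; rewrite tnth_mktuple permM permKV.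
rewrite (odd_permM u s^-1%g) odd_permV signr_addb [in LHS](mulrC ((-1) ^+ u)) -mulrA.
congr (_ * (_ * oapp _ _ (insub _))).
by apply/fsetP => k; rewrite !inE mem_tuple_perm.
Qed.

Lemma altext_sorted t (I : nsubset n) :
  sorted ltn t -> [fset k in tval t] = I -> altext p t = p I.
Proof.
move=> ts tI; have tu := sorted_uniq ltn_trans ltnn ts.
rewrite /altext (big_pred1 1%g) => [|s /=].
  by rewrite odd_perm1 expr0 mul1r tI valK.
apply/idP/eqP => [us|->]; last first.
  rewrite (@eq_map _ _ _ (tnth t)) => [|i]; first by rewrite map_tnth_enum.
  by rewrite perm1.
have e : [tuple tnth t (s i) | i < n] = t.
  apply: val_inj; apply: (irr_sorted_eq ltn_trans ltnn us ts).
  exact: mem_tuple_perm.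
apply/permP => i; rewrite perm1; move/tuple_uniqP: tu; apply.
by rewrite -[in RHS]e tnth_mktuple.
Qed.

End AltextSpec.

(* Main.v *)
Require Import Defs.
From mathcomp Require Import all_boot all_order all_algebra all_fingroup finmap.
From mathcomp Require Import complex.
From mathcomp Require Import all_classical all_reals all_analysis.

Set Implicit Arguments.
Unset Strict Implicit.
Unset Printing Implicit Defensive.

Import Order.TTheory GRing.Theory Num.Theory.

Local Open Scope ring_scope.
Local Open Scope complex_scope.

(** Write [j] for the increasing enumeration of [J] and [w t k] for the
    Plücker frame. The relation with [S = (k, j_1, .., j_n)] reads
    [p_J p~(R, k) = \sum_t w t k * p~(R, j_t)], so by alternation [p~] is
    determined, slot by slot, by its values on tuples of elements of [J]; the
    determinant of the coordinates [(p_J)^-1 * w t k] satisfies the same slot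
    expansion. Up to sign, the nonzero values of [w t] are coordinates of [p]
    at distinct [n]-subsets, hence [w t] is as summable as [p]. *)

Definition upd n (T : Type) (x : 'I_n -> T) (m : 'I_n) (k : T) : 'I_n -> T :=
  fun i => if i == m then k else x i.

(** * Alternating functions and determinants *)

Section AlternatingDet.
Variables (K : comPzRingType) (T : Type) (n : nat).
Variables (j : 'I_n -> T) (w : 'I_n -> T -> K).
Hypothesis wj : forall r s, w r (j s) = (r == s)%:R.

Let D (x : 'I_n -> T) := \det (\matrix_(r, s) w r (x s)).

(** Laplace expansion along column [m]: writing [j t] into slot [m] turns that column into a basis
    vector, so the new determinant is the cofactor at row [t]. *)
Lemma det_coord_slot x m : D x = \sum_t w t (x m) * D (upd x m (j t)).
Proof.
rewrite {1}/D (expand_det_col _ m); apply: eq_bigr => t _; rewrite mxE.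
congr (_ * _); rewrite /D (expand_det_col _ m) (bigD1 t) //= big1 => [|i it].
  rewrite mxE /upd eqxx wj eqxx mul1r addr0 /cofactor; congr (_ * \det _).
  by apply/matrixP => a b; rewrite !mxE eq_sym (negPf (neq_lift _ _)).
by rewrite mxE /upd eqxx wj (negPf it) mul0r.
Qed.

Variable F : ('I_n -> T) -> K.
Hypothesis Frep : forall x a b, a != b -> x a = x b -> F x = 0.
Hypothesis Fperm : forall x (s : 'S_n), F (x \o s) = (-1) ^+ s * F x.
Hypothesis Fslot : forall x m, F x = \sum_t w t (x m) * F (upd x m (j t)).

(** An injective [g] is a permutation, and [D] is then its sign; otherwise an entry repeats and both
    sides vanish. *)
Lemma alternating_frame_det (g : 'I_n -> 'I_n) : F (j \o g) = F j * D (j \o g).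
Proof.
have [/injectiveP gi|/injectivePn[a [b ab gab]]] := boolP (injectiveb g).
  have -> : g = perm gi by apply/funext => i; rewrite permE.
  rewrite Fperm mulrC; congr (_ * _); rewrite -det_perm -det_tr.
  by congr determinant; apply/matrixP => r s; rewrite !mxE /= wj eq_sym.
rewrite (Frep ab) /= ?gab // /D -det_tr (determinant_alternate ab) ?mulr0 //.
by move=> i; rewrite !mxE /= gab.
Qed.

(* Expanding the slots one at a time reduces to the case where all the entries
   are among the j's. *)
Lemma alternating_det x : F x = F j * D x.
Proof.
(* Only the slots below [m] may still hold arbitrary entries; for [m = n] the condition is
   vacuous. *)
suff H m : forall x, (forall i : 'I_n, (m <= i)%N -> exists s, x i = j s) ->
    F x = F j * D x.
  by apply: (H n) => i; rewrite leqNgt ltn_ord.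
elim: m => [|m IH] {}x xj.
  have [g xg] : {g : 'I_n -> 'I_n & forall i, x i = j (g i)}.
    by apply: (@choice _ _ (fun i s => x i = j s)) => i; apply: xj.
  by have -> : x = j \o g by [exact/funext]; exact: alternating_frame_det.
have [nm|mn] := leqP n m.
  by apply: IH => i mi; have := leq_trans nm mi; rewrite leqNgt ltn_ord.
rewrite (Fslot x (Ordinal mn)) (det_coord_slot x (Ordinal mn)) mulr_sumr.
apply: eq_bigr => t _; rewrite mulrCA; congr (_ * _); apply: IH => i mi.
rewrite /upd; have [_|im] := eqVneq i (Ordinal mn); first by exists t.
by apply: xj; rewrite ltn_neqAle mi andbT eq_sym -val_eqE in im *.
Qed.

End AlternatingDet.

(** * Scaling and injective reindexing in [ellp] and [c_null] *)

Section Summable.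
Variable R : realType.
Local Open Scope classical_set_scope.

Lemma in_space_scale (E : seq_space R) (Omega : countType) (x : Omega -> R[i])
    (c : R[i]) : in_space E x -> in_space E (fun k => c * x k).
Proof.
have nc (z : R[i]) : 0 <= Normc.normc z by case: z => a b; rewrite sqrtr_ge0.
case: E => [q|] /= xE.
  under eq_esum do rewrite Normc.normcM powRM // EFinM.
  suff -> : \esum_(i in [set: Omega])
      ((Normc.normc c `^ q%:num)%:E * (Normc.normc (x i) `^ q%:num)%:E)%E =
    ((Normc.normc c `^ q%:num)%:E *
     \esum_(i in [set: Omega]) (Normc.normc (x i) `^ q%:num)%:E)%E.
    by rewrite lte_mul_pinfty ?lee_fin ?powR_ge0.
  rewrite /esum -ereal_supZl ?powR_ge0 //; last first.
    by apply/set0P/image_nonempty; exists set0; apply: fsets_set0.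
  congr ereal_sup; rewrite image_comp; apply: eq_imagel => A _ /=.
  by rewrite ge0_mule_fsumr // => i; rewrite lee_fin powR_ge0.
move=> e e0; have [c0|c0] := eqVneq (Normc.normc c) 0.
  by apply: (sub_finite_set _ (finite_set0 _)) => i /=;
    rewrite Normc.normcM c0 mul0r leNgt e0.
have cp : 0 < Normc.normc c by rewrite lt_def c0 nc.
apply: (sub_finite_set _ (xE (e / Normc.normc c) (divr_gt0 e0 cp))) => i /=.
by rewrite Normc.normcM ler_pdivrMr // mulrC.
Qed.

(** Up to moduli, [y] on [A] is a subfamily of [x] listed without repetition, so its sum and the
    size of its level sets are bounded by those of [x]. *)
Lemma in_space_reindex (E : seq_space R) (Omega Omega' : countType)
    (x : Omega -> R[i]) (y : Omega' -> R[i]) (A : set Omega')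
    (g : Omega' -> Omega) :
  set_inj A g -> (forall k, ~ A k -> y k = 0) ->
  (forall k, A k -> Normc.normc (y k) = Normc.normc (x (g k))) ->
  in_space E x -> in_space E y.
Proof.
move=> ginj y0 yx; case: E => [q|] /= xE; last first.
  move=> e e0; apply: (@sub_finite_set _ _
    (A `&` g @^-1` [set i | e <= Normc.normc (x i)])).
    move=> k /= ek; have [Ak|/y0 yk] := pselect (A k); first by rewrite -yx.
    by move: ek; rewrite yk Normc.normc0 leNgt e0.
  set B := _ `&` _; rewrite -(@eq_finite_set _ _ (g @` B)).
    apply: sub_finite_set (xE e e0) => _ [k [_ ek] <-]; exact: ek.
  by apply: inj_card_eq => k l /set_mem[Ak _] /set_mem[Al _];
    apply: ginj; apply: mem_set.
have ge0 (a : R) : (0 <= (a `^ q%:num)%:E)%E by rewrite lee_fin powR_ge0.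
rewrite (_ : \esum_(i in _) _ =
    \esum_(i in g @` A) (Normc.normc (x i) `^ q%:num)%:E); last first.
  rewrite esum_image // [RHS]esum_mkcond; apply: eq_esum => k _.
  have [Ak|Ak] := pselect (A k); first by rewrite mem_set ?yx.
  (* Zero entries contribute nothing because the exponent is positive. *)
  by rewrite memNset ?y0 ?Normc.normc0 ?powR0 ?gt_eqF.
apply: le_lt_trans xE; rewrite esum_mkcond; apply: le_esum => i _.
by case: ifP.
Qed.
End Summable.

(** * Coordinates up to sign, and membership of the frame in [E] *)

Section Plucker.
Variables (R : realType) (n : nat) (p : nsubset n -> R[i]).

Lemma sorted_sort_nsubset (I : nsubset n) : sorted ltn (sort leq (enum_fset I)).
Proof.
by rewrite ltn_sorted_uniq_leq sort_uniq fset_uniq (sort_sorted leq_total).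
Qed.

Lemma size_sort_nsubset (I : nsubset n) : size (sort leq (enum_fset I)) = n.
Proof. by rewrite size_sort; apply/eqP; case: I. Qed.

Lemma nelt_tupleE (I : nsubset n) :
  [tuple nelt I s | s < n] = sort leq (enum_fset I) :> seq nat.
Proof.
apply: (@eq_from_nth _ 0%N); first by rewrite size_tuple size_sort_nsubset.
move=> i; rewrite size_tuple => ni.
by rewrite -(tnth_nth _ _ (Ordinal ni)) tnth_mktuple.
Qed.

Lemma nelt_inj (I : nsubset n) : injective (nelt I).
Proof.
have /tuple_uniqP ui : uniq [tuple nelt I s | s < n].
  by rewrite nelt_tupleE sort_uniq fset_uniq.
by move=> a b ab; apply: ui; rewrite !tnth_mktuple.
Qed.

Lemma fset_nelt (I : nsubset n) :
  [fset k in tval [tuple nelt I s | s < n]]%fset = I.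
Proof.
by apply/fsetP => k; rewrite !inE /= nelt_tupleE mem_sort.
Qed.

Lemma altext_nelt (I : nsubset n) : altext p [tuple nelt I s | s < n] = p I.
Proof.
by apply: altext_sorted (fset_nelt I); rewrite nelt_tupleE sorted_sort_nsubset.
Qed.

(** Since [I] has [n] elements, [t] has no repetition and permutes the increasing enumeration of
    [I]; only a sign is lost. *)
Lemma normc_altext (t : n.-tuple nat) (I : nsubset n) :
  [fset k in tval t]%fset = I -> Normc.normc (altext p t) = Normc.normc (p I).
Proof.
move=> tI; have tu : uniq t.
  rewrite -[uniq _]negbK -ltn_size_undup -leqNgt -card_fseq tI size_tuple.
  by case: I {tI} => I /= /eqP->.
have /tuple_permP[s ts] : perm_eq t [tuple nelt I s | s < n].
  apply: uniq_perm tu _ _ => [|k].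
    by rewrite nelt_tupleE sort_uniq fset_uniq.
  by have /fsetP/(_ k) := etrans tI (esym (fset_nelt I)); rewrite !inE.
rewrite (val_inj ts : t = _) altext_perm altext_nelt Normc.normcM.
by case: odd_perm; rewrite ?expr0 ?expr1 ?normcN Normc.normc1 mul1r.
Qed.

Lemma plucker_frame_nelt (J : nsubset n) (r s : 'I_n) :
  plucker_frame p J r (nelt J s) = p J * (r == s)%:R.
Proof.
rewrite /plucker_frame; have [->|rs] := eqVneq r s.
  rewrite mulr1 -altext_nelt; congr altext; apply: eq_from_tnth => i.
  by rewrite !tnth_mktuple; case: eqP => [->|].
rewrite mulr0 altext_repeat //; apply: contra rs => /tuple_uniqP ui.
by apply/eqP/ui; rewrite !tnth_mktuple eqxx; case: eqP.
Qed.

Lemma plucker_frame_in_space (E : seq_space R) (J : nsubset n) (r : 'I_n) :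
  in_space E p -> in_space E (plucker_frame p J r).
Proof.
pose t k := [tuple upd (nelt J) r k i | i < n].
(* [g k] is [J] with its [r]-th element replaced by [k]. The default [J] occurs only when [k]
   repeats another element of [J], where the frame vector vanishes. *)
pose g k : nsubset n := insubd J [fset i in tval (t k)]%fset.
have gE k : uniq (t k) -> g k = [fset i in tval (t k)]%fset :> {fset nat}.
  move=> tu; apply: insubdK; apply/eqP.
  by rewrite card_fseq undup_id ?size_tuple.
have gP k (i : nat) : uniq (t k) ->
    (i \in nsubset_fset (g k)) = (i \in tval (t k)).
  by move=> tu; rewrite gE // !inE.
apply: (@in_space_reindex _ _ _ _ _ _ [set k | uniq (t k)]%classic g).
- move=> k l /set_mem uk /set_mem ul gkl.
  (* As an element of [g l], [k] is either [l] or a remaining element of [J]; the latter would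
     repeat an entry in [t k]. *)
  have : (k : nat) \in nsubset_fset (g l).
    rewrite -gkl gP //; apply/tnthP; exists r.
    by rewrite tnth_mktuple /upd eqxx.
  rewrite gP // => /tnthP [s]; rewrite tnth_mktuple /upd.
  case: eqVneq => [_ -> //|sr kJ].
  move/tuple_uniqP: uk => /(_ r s); rewrite !tnth_mktuple /upd eqxx (negPf sr).
  by move/(_ kJ)/esym/eqP; rewrite (negPf sr).
- by move=> k /negP; apply: altext_repeat.
- by move=> k uk; apply: normc_altext; rewrite gE.
Qed.

End Plucker.

(** * From the Plücker relations to the slot expansion and the determinant *)

Lemma snoc_mktuple n (y : 'I_n.+1 -> nat) k :
  snoc (n := n.+1) [tuple y (lift ord_max i) | i < n] k =
  [tuple upd y ord_max k i | i < n.+1].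
Proof.
apply: eq_from_tnth => i; rewrite !tnth_mktuple nth_rcons size_tuple /upd.
case: (unliftP ord_max i) => [i' ->|->]; last by rewrite /= ltnn !eqxx.
rewrite lift_max ltn_ord eq_sym (negPf (neq_lift _ _)).
by rewrite -tnth_nth tnth_mktuple.
Qed.

Section PluckerSlot.
Variables (R : realType) (n : nat) (p : nsubset n.+1 -> R[i]).
Variable J : nsubset n.+1.
Hypothesis hp : plucker p.

Lemma plucker_snoc (r : n.-tuple nat) k :
  p J * altext p (snoc (n := n.+1) r k) =
  \sum_t plucker_frame p J t k * altext p (snoc (n := n.+1) r (nelt J t)).
Proof.
have := hp r [tuple of k :: [tuple nelt J s | s < n.+1]].
rewrite big_ord_recl expr1 mulN1r tnth0.
have -> : omit [tuple of k :: [tuple nelt J s | s < n.+1]] ord0 =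
    [tuple nelt J s | s < n.+1].
  by apply: eq_from_tnth => i; rewrite !tnth_mktuple tnthS tnth_mktuple.
rewrite altext_nelt mulNr addrC => /eqP; rewrite subr_eq0 mulrC => /eqP <-.
apply: eq_bigr => t _; rewrite tnthS tnth_mktuple.
(* Substituting [k] for [j_t] in [J] and moving slot [t] to the front, by a cycle of sign [(-1)^t],
   gives [k, j_1, .., j_n] without [j_t]. *)
have -> : omit [tuple of k :: [tuple nelt J s | s < n.+1]] (lift ord0 t) =
    [tuple tnth [tuple upd (nelt J) t k i | i < n.+1] (lift_perm ord0 t 1%g i)
       | i < n.+1].
  apply: eq_from_tnth => i; rewrite !tnth_mktuple.
  have [->|[i' ->]] : i = ord0 \/ exists i', i = lift ord0 i'.
    by case: (unliftP ord0 i) => [i' ->|->]; [right; exists i'|left].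
    by rewrite lift_perm_id /upd eqxx.
  rewrite lift_perm_lift perm1 /upd.
  rewrite [lift t _ == t]eq_sym (negPf (neq_lift _ _)).
  have -> : lift (lift ord0 t) (lift ord0 i') = lift ord0 (lift t i').
    by apply: val_inj; rewrite /= /bump /= !add1n ltnS addnS.
  by rewrite tnthS tnth_mktuple.
rewrite altext_perm odd_lift_perm odd_perm1 addbF /= signr_odd.
(* The sign [(-1)^(t+2)] of the relation cancels that of the cycle. *)
rewrite /bump leq0n add1n !exprS !mulN1r opprK mulrACA -exprMn.
by rewrite mulrNN mul1r expr1n mul1r; exact: mulrC.
Qed.

Lemma plucker_slot (x : 'I_n.+1 -> nat) (m : 'I_n.+1) :
  p J * altext p [tuple x i | i < n.+1] =
  \sum_t plucker_frame p J t (x m) *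
    altext p [tuple upd x m (nelt J t) i | i < n.+1].
Proof.
pose s := tperm m ord_max.
(* Swapping slot [m] with the last one costs a sign independent of [k], which is common to both
   sides of the expansion. *)
have E k : altext p [tuple upd x m k i | i < n.+1] =
    (-1) ^+ s *
    altext p (snoc (n := n.+1) [tuple x (s (lift ord_max i)) | i < n] k).
  rewrite -altext_perm (snoc_mktuple (x \o s)); congr altext.
  apply: eq_from_tnth => i; rewrite !tnth_mktuple /upd /= tpermK.
  by rewrite (can2_eq (tpermK _ _) (tpermK _ _)) tpermR.
have {1}-> : x = upd x m (x m).
  by apply/funext => i; rewrite /upd; case: eqP => [->|].
rewrite E mulrCA plucker_snoc mulr_sumr; apply: eq_bigr => t _.
by rewrite E mulrCA.
Qed.

Lemma plucker_det (pJ : p J != 0) (x : 'I_n.+1 -> nat) :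
  altext p [tuple x i | i < n.+1] =
  p J * \det (\matrix_(r, s) ((p J)^-1 * plucker_frame p J r (x s))).
Proof.
rewrite -[X in X * \det _](altext_nelt p J).
pose F (y : 'I_n.+1 -> nat) := altext p [tuple y i | i < n.+1].
apply: (@alternating_det _ _ _ (nelt J)
  (fun r k => (p J)^-1 * plucker_frame p J r k) _ F).
- by move=> r s; rewrite plucker_frame_nelt mulKf.
- move=> y a b ab yab; apply: altext_repeat.
  apply: contra ab => /tuple_uniqP yi.
  by apply/eqP/yi; rewrite !tnth_mktuple.
- move=> y s; rewrite -altext_perm; congr altext.
  by apply: eq_from_tnth => i; rewrite !tnth_mktuple.
- move=> y m; apply: (mulfI pJ); rewrite (plucker_slot y m) mulr_sumr.
  by apply: eq_bigr => t _; rewrite mulrA mulVKf.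
Qed.

(** Row factors with product [p J] absorb the constant in front of the determinant; this serves both
    an arbitrary nonzero [p J] and the explicit frame when [p J = 1]. *)
Lemma scaled_plucker_frame (E : seq_space R) (a : 'I_n.+1 -> R[i]) :
  in_space E p -> p J != 0 -> \prod_r a r = p J ->
  is_frame E p (fun r k => a r * ((p J)^-1 * plucker_frame p J r k)).
Proof.
move=> pE pJ aJ; split=> [r|c c0 r|I].
- by do 2!apply: in_space_scale; apply: plucker_frame_in_space.
(* Evaluating the relation at [j_r] leaves [c r * a r = 0], and [a r] divides the nonzero [p J]. *)
- have := c0 (nelt J r); rewrite (bigD1 r) //= big1 => [|s /negPf sr].
    rewrite plucker_frame_nelt eqxx mulr1 mulVf // mulr1 addr0 => /eqP.
    rewrite mulf_eq0 => /orP[/eqP //|ar].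
    by move: pJ; rewrite -aJ (bigD1 r) //= (eqP ar) mul0r eqxx.
  by rewrite plucker_frame_nelt sr !mulr0.
rewrite -altext_nelt plucker_det // -aJ.
have -> : \prod_r a r = \det (diag_mx (\row_r a r)).
  by rewrite det_diag; apply: eq_bigr => r _; rewrite mxE.
rewrite -det_mulmx mul_diag_mx; congr determinant.
by apply/matrixP => r s; rewrite !mxE.
Qed.

End PluckerSlot.

Theorem theorem3p1 (R : realType) (n : nat) (hn : (1 <= n)%N)
    (E : seq_space R) (p : nsubset n -> R[i])
    (pE : in_space E p) (p_neq0 : p <> (fun=> 0)) (hp : plucker p) :
  (exists w : 'I_n -> nat -> R[i], is_frame E p w) /\
  (forall J0 : nsubset n, p J0 = 1 ->
     is_frame E p (plucker_frame p J0) /\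
     forall r s : 'I_n, plucker_frame p J0 r (nelt J0 s) = (r == s)%:R).
Proof.
case: n hn p pE p_neq0 hp => // n _ p pE p_neq0 hp; split=> [|J pJ].
  have [J /eqP pJ] : exists J, p J <> 0.
    by apply/existsNP => p0; apply/p_neq0/funext.
  (* The whole factor [p J] is put into the first row. *)
  pose a (r : 'I_n.+1) := if r == ord0 then p J else 1.
  eexists; apply: (@scaled_plucker_frame _ _ _ J hp E a pE pJ).
  by rewrite (bigD1 ord0) //= big1 ?mulr1 // => r /negPf r0; rewrite /a r0.
split=> [|r s]; last by rewrite plucker_frame_nelt pJ mul1r.
have -> : plucker_frame p J = fun r k => 1 * ((p J)^-1 * plucker_frame p J r k).
  by apply/funext => r; apply/funext => k; rewrite pJ invr1 !mul1r.
by apply: scaled_plucker_frame; rewrite ?pJ ?oner_eq0 ?big1.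
Qed.
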